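(* Let $d\ge2$ be an integer and $\alpha>-\frac12$ a real number with $\alpha>\frac d2-1$. There exists a constant $c>0$, depending only on $\alpha$ and $d$, such that for every $x\in\mathbb{R}^d_+$ and every $\varepsilon>0$, $$0\le\tau_x(\chi_{B^+(0,\varepsilon)})(-y',y_d)\le c\,\frac{\nu_\alpha(B^+(0,\varepsilon))}{\nu_\alpha(C^+(x,\varepsilon))}\quad\text{for a.e. } y=(y',y_d)\in\mathbb{R}^d_+.$$
   Context: $\mathbb{R}^d_+=\mathbb{R}^{d-1}\times(0,+\infty)$; points are written $x=(x',x_d)$ with $x'=(x_1,\dots,x_{d-1})\in\mathbb{R}^{d-1}$, $x_d>0$. The measure $\nu_\alpha$ on $\mathbb{R}^d_+$ is $$d\nu_\alpha(x)=\frac{x_d^{2\alpha+1}}{(2\pi)^{\frac{d-1}{2}}2^\alpha\Gamma(\alpha+1)}\,dx,$$ where $dx$ is Lebesgue measure; ''a.e.'' is with respect to $\nu_\alpha$ (equivalently, Lebesgue measure). For $\varepsilon>0$, $B^+(0,\varepsilon)=B(0,\varepsilon)\cap\mathbb{R}^d_+$, where $B(0,\varepsilon)$ is the closed Euclidean ball of $\mathbb{R}^d$ with center $0$ and radius $\varepsilon$; $\chi_A$ is the characteristic function of $A$. For $x=(x',x_d)\in\mathbb{R}^d_+$ and $\varepsilon>0$, $$C^+(x,\varepsilon)=B_{d-1}(x',\varepsilon)\times\,]\max\{0,x_d-\varepsilon\},\,x_d+\varepsilon[,$$ where $B_{d-1}(x',\varepsilon)$ is the closed Euclidean ball of $\mathbb{R}^{d-1}$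 with center $x'$ and radius $\varepsilon$. For $x_d,y_d,\rho>0$ let $$W_\alpha(x_d,y_d,\rho)=\frac{\Gamma(\alpha+1)\,\big((x_d+y_d)^2-\rho^2\big)^{\alpha-\frac12}\big(\rho^2-(x_d-y_d)^2\big)^{\alpha-\frac12}}{2^{2\alpha-1}\sqrt{\pi}\,\Gamma(\alpha+\frac12)\,(x_dy_d\rho)^{2\alpha}}$$ if $|x_d-y_d|<\rho<x_d+y_d$, and $W_\alpha(x_d,y_d,\rho)=0$ otherwise. The Weinstein translation of $\chi_{B^+(0,\varepsilon)}$ by $x\in\mathbb{R}^d_+$ is given, for $y=(y',y_d)\in\mathbb{R}^d_+$, by $$\tau_x(\chi_{B^+(0,\varepsilon)})(-y',y_d)=\int_0^{+\infty}\chi_{B^+(0,\varepsilon)}(x'-y',\rho)\,W_\alpha(x_d,y_d,\rho)\,\rho^{2\alpha+1}\,d\rho.$$ *)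

(* Defs.v *)
From HB Require Import structures.
From mathcomp Require Import all_boot all_order all_algebra.
From mathcomp Require Import all_classical all_reals all_analysis.
From mathcomp Require Import measurable_realfun.

Set Implicit Arguments.
Unset Strict Implicit.
Unset Printing Implicit Defensive.

Import Order.TTheory GRing.Theory Num.Theory.
Import numFieldNormedType.Exports.

Local Open Scope classical_set_scope.
Local Open Scope ring_scope.

(* Borel-measurable R^n, and R^d split as x = (x', x_d). measurableTypeR is *)
(* the structure on R that carries lebesgue_measure; without it, Rocq may   *)
(* infer the same sigma-algebra under another display.                      *)
Notation Rn R n := (n.-tuple (measurableTypeR R)).
Notation Rd R d := (Rn R d.-1 * measurableTypeR R)%type.

Section euclidean.
Context {R : realType}.

Definition taddv n (u v : Rn R n) : Rn R n :=
  [tuple tnth u i + tnth v i | i < n].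

Definition toppv n (u : Rn R n) : Rn R n :=
  [tuple - tnth u i | i < n].

Definition sqnorm n (u : Rn R n) : R := \sum_(i < n) tnth u i ^+ 2.

Definition eball n (u : Rn R n) (r : R) : set (Rn R n) :=
  [set v | Num.sqrt (sqnorm (taddv v (toppv u))) <= r].

Definition tcons n (p : Rn R n * measurableTypeR R) : Rn R n.+1 :=
  [tuple of p.2 :: p.1].

Lemma measurable_tcons n : measurable_fun setT (@tcons n).
Proof.
by apply: measurable_cons; [exact: measurable_snd|exact: measurable_fst].
Qed.

(* Pushforward of m x lebesgue_measure by tcons; the head term is the HB *)
(* instance making a pushforward along a measurable map a measure.       *)
Definition lebesgue_cons n (m : {measure set (Rn R n) -> \bar R}) :
    {measure set (Rn R n.+1) -> \bar R} :=
  measure_function_pushforward__canonical__measure_function_Measure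
    (m \x (@lebesgue_measure R))%E (@measurable_tcons n).

Fixpoint lebesgue_tuple n : {measure set (Rn R n) -> \bar R} :=
  match n with
  | 0 => dirac [tuple]
  | m.+1 => lebesgue_cons (lebesgue_tuple m)
  end.
End euclidean.

Section halfspace.
Context {R : realType}.

Definition Gamma (a : R) : R :=
  \int[lebesgue_measure]_(t in `]0, +oo[) (t `^ (a - 1) * expR (- t)).

Definition halfspace d : set (Rd R d) := [set x | 0 < x.2].
Arguments halfspace d _ : clear implicits.

Definition nu_density d (alpha : R) (x : Rd R d) : R :=
  x.2 `^ (2 * alpha + 1) /
  ((2 * pi) `^ ((d%:R - 1) / 2) * 2 `^ alpha * Gamma (alpha + 1)).

Definition nu d (alpha : R) (A : set (Rd R d)) : \bar R :=
  (\int[(lebesgue_tuple d.-1 \x lebesgue_measure)]_(x in A `&` halfspace d)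
     (nu_density alpha x)%:E)%E.

Lemma Gamma_ge0 a : 0 <= Gamma a.
Proof.
by apply: Rintegral_ge0 => // t _; rewrite mulr_ge0 ?powR_ge0 ?expR_ge0.
Qed.

Lemma nu_density_ge0 d alpha (x : Rd R d) : 0 <= nu_density alpha x.
Proof. by rewrite divr_ge0 ?mulr_ge0 ?powR_ge0 ?Gamma_ge0. Qed.

Lemma measurable_nu_density d alpha :
  measurable_fun setT (@nu_density d alpha).
Proof.
apply: measurable_funM => //.
apply: (measurableT_comp (measurable_powR (2 * alpha + 1))).
exact: measurable_snd.
Qed.

Lemma measurable_halfspace d : measurable (halfspace d).
Proof.
have -> : halfspace d = [set: Rn R d.-1] `*` `]0, +oo[%classic.
  by apply/seteqP; split => x /=; rewrite in_itv/= andbT //; case.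
by apply: measurableX.
Qed.

Section nu_measure.
Context (d : nat) (alpha : R).
Local Notation nu := (@nu d alpha).

Let nu0 : nu set0 = 0%E.
Proof. by rewrite /nu set0I integral_set0. Qed.

Let nu_ge0 A : (0 <= nu A)%E.
Proof. by apply: integral_ge0 => x _; rewrite lee_fin nu_density_ge0. Qed.

Let nu_sigma_additive : semi_sigma_additive nu.
Proof.
move=> F mF tF mUF.
have mH := @measurable_halfspace d.
rewrite /nu setI_bigcupl ge0_integral_bigcup//=.
- apply: is_cvg_ereal_nneg_natsum_cond => n _ _.
  by apply: integral_ge0 => x _; rewrite lee_fin nu_density_ge0.
- by move=> k; exact: measurableI.
- apply: measurable_funTS; apply/measurable_EFinP.
  exact: measurable_nu_density.
- by move=> x _; rewrite lee_fin nu_density_ge0.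
- exact: trivIset_setIr.
Qed.

HB.instance Definition _ := isMeasure.Build _ _ _
  nu nu0 nu_ge0 nu_sigma_additive.
End nu_measure.

Definition Bplus d (eps : R) : set (Rd R d) :=
  [set x | Num.sqrt (sqnorm x.1 + x.2 ^+ 2) <= eps] `&` halfspace d.

Definition Cplus d (x : Rd R d) (eps : R) : set (Rd R d) :=
  eball x.1 eps `*` `]Num.max 0 (x.2 - eps), x.2 + eps[.

Definition W (alpha s t rho : R) : R :=
  if `|s - t| < rho < s + t then
    Gamma (alpha + 1) * ((s + t) ^+ 2 - rho ^+ 2) `^ (alpha - 1 / 2)
      * (rho ^+ 2 - (s - t) ^+ 2) `^ (alpha - 1 / 2)
    / (2 `^ (2 * alpha - 1) * Num.sqrt pi * Gamma (alpha + 1 / 2)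
       * (s * t * rho) `^ (2 * alpha))
  else 0.

(* The sign convention tau_x f (y', y_d) integrates f (x' + y', .), so that *)
(* evaluation at (- y', y_d) gives f (x' - y', .).                          *)
(* The value is an extended real, so that the integral of a nonnegative     *)
(* function is meaningful without an integrability hypothesis.              *)
Definition weinstein_translation d (alpha : R) (x : Rd R d)
    (f : Rd R d -> R) (y : Rd R d) : \bar R :=
  (\int[lebesgue_measure]_(rho in `]0%R, +oo[)
     (f (taddv x.1 y.1, rho) * W alpha x.2 y.2 rho
        * rho `^ (2 * alpha + 1))%:E)%E.

End halfspace.

Arguments halfspace {R} d _.
Arguments nu {R} d alpha A.
Arguments Bplus {R} d eps _.

(* Main.v *)
Require Import Defs.
From mathcomp Require Import all_boot all_order all_algebra.
From mathcomp Require Import all_classical all_reals all_analysis.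
From mathcomp Require Import measurable_realfun ring lra.
Import Order.TTheory GRing.Theory Num.Theory.
Import numFieldNormedType.Exports.
Local Open Scope classical_set_scope.
Local Open Scope ring_scope.

(** Why the bound holds.  Write s = x_d, t = y_d, b = alpha - 1/2 > -1 and
    g = 2 alpha + 1 > 0.  Both sides are compared with (eps / (s + eps)) ^ g.

    The ratio of measures is at least a multiple of it ([nu_ratio_ge]): up to
    dimensional constants, B+(0, eps) contains a box of side eps at height of
    order eps, so its measure is at least eps ^ (d + g), while C+(x, eps) lies
    in a box of side 2 eps at height at most s + eps, so its measure is at most
    eps ^ d (s + eps) ^ g.

    The translation is at most a multiple of it ([integral_W_le]).  Forgetting
    the tangential variable only enlarges the integrand, which leaves
    W(s, t, rho) rho ^ g on 0 < rho <= eps.  Up to a constant this weight is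
    (s t) ^ (- 2 alpha) (Q^2 - rho^2) ^ b (rho^2 - p^2) ^ b rho, where
    p = |s - t|, Q = s + t and Q^2 - p^2 = 4 s t.  The sum of the two brackets
    is 4 s t, so one of them is comparable to 4 s t, and what remains are
    functions like (rho^2 - p^2) ^ b rho, which have an explicit primitive and
    an integrable singularity since b + 1 > 0.
    - If eps >= s / 4, integrating over ]p, Q[ bounds the translation by a
      constant ([integral_W_le_const]), and eps / (s + eps) is bounded below.
    - If eps < s / 4, only the singularity at p is met.  The integral is at most
      a multiple of (eps^2 / (s t)) ^ (b + 1), and t > s / 2 whenever the
      integrand is not identically zero, which gives (eps / s) ^ g
      ([integral_W_le_small_radius]). *)

(** * Integrals of functions with integrable endpoint singularities *)

(** The integral over compact subintervals is an increment of [F], hence at most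
    [F q - F p] by monotonicity; monotone convergence then reaches the open
    interval.  The integrals of interest have [f] unbounded at an endpoint. *)
Lemma le_integral_antideriv (R : realType) (f F : R -> R) (p q : R) :
  {in `]p, q[, forall x : R, is_derive x 1 F (f x)} ->
  {in `]p, q[, continuous f} ->
  {in `]p, q[, forall x, 0 <= f x} ->
  {in `[p, q] &, {homo F : x y / x <= y}} -> p <= q ->
  (\int[lebesgue_measure]_(x in `]p, q[) (f x)%:E <= (F q - F p)%:E)%E.
Proof.
move=> dF cf f0 ndF pq.
pose A n : set R := `[p + n.+1%:R^-1, q - n.+1%:R^-1]%classic.
have AS n x : A n x -> x \in `]p, q[.
  rewrite /A /= !in_itv/= => /andP[px xq]; apply/andP; split.
    by rewrite (lt_le_trans _ px)// ltrDl invr_gt0.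
  by rewrite (le_lt_trans xq)// gtrDl oppr_lt0 invr_gt0.
have -> : `]p, q[%classic = \bigcup_n A n.
  apply/seteqP; split => x; last by move=> [n _ /AS].
  rewrite /= in_itv/= => /andP[px xq].
  have m0 : 0 < Num.min (x - p) (q - x) by rewrite lt_min !subr_gt0 px.
  have [n _ hn] := near_infty_natSinv_lt (PosNum m0).
  have : n.+1%:R^-1 < Num.min (x - p) (q - x) := hn n (leqnn n).
  rewrite lt_min => /andP[h1 h2].
  exists n => //; rewrite /A/= in_itv/=; apply/andP; split.
    by rewrite -lerBrDl ltW.
  by rewrite lerBrDl -lerBrDr ltW.
have cvgA : (\int[lebesgue_measure]_(x in A n) (f x)%:E)%E @[n --> \oo] -->
    (\int[lebesgue_measure]_(x in \bigcup_n A n) (f x)%:E)%E.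
  apply: ge0_nondecreasing_set_cvg_integral => //.
  - move=> n m nm; apply/subsetPset => x.
    rewrite /A /= !in_itv/= => /andP[h1 h2].
    have h : m.+1%:R^-1 <= n.+1%:R^-1 :> R by rewrite lef_pV2 ?posrE// ler_nat.
    by rewrite (le_trans _ h1) ?lerD2l// (le_trans h2)// lerB.
  - by move=> n; exact: measurable_itv.
  - move=> n; apply/measurable_EFinP.
    apply: subspace_continuous_measurable_fun; first exact: measurable_itv.
    by apply: continuous_in_subspaceT => x /set_mem /AS; exact: cf.
  - by move=> n x /AS xpq; rewrite lee_fin f0.
rewrite -(cvg_lim _ cvgA)//; apply: lime_le.
  by apply/cvg_ex; eexists; exact: cvgA.
apply: nearW => n /=.
have pp : p \in `[p, q] by rewrite in_itv/= lexx.
have qq : q \in `[p, q] by rewrite in_itv/= lexx andbT.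
have [ab|ba] := ltP (p + n.+1%:R^-1) (q - n.+1%:R^-1); last first.
  rewrite (_ : \int[_]_(x in _) _ = 0)%E ?lee_fin ?subr_ge0 ?ndF//.
  apply: (integral_Sset1 (p + n.+1%:R^-1)) => x.
  rewrite /A/= in_itv/= => /andP[h1 h2]; apply/eqP.
  by rewrite eq_le h1 (le_trans h2 ba).
have memA x : A n x -> x \in `[p, q].
  by move=> /AS; exact: subset_itv_oo_cc.
have Al : A n (p + n.+1%:R^-1) by rewrite /A/= in_itv/= lexx ltW.
have Ar : A n (q - n.+1%:R^-1) by rewrite /A/= in_itv/= lexx ltW.
have cF x : A n x -> F y @[y --> x] --> F x.
  move=> /AS /dF [dFx _].
  exact/differentiable_continuous/derivable1_diffP.
rewrite /A (@continuous_FTC2 _ f F)//.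
- rewrite -EFinB lee_fin lerB// ndF// ?memA//.
    by rewrite gerDl oppr_le0 invr_ge0.
  by rewrite lerDl invr_ge0.
- by apply: continuous_in_subspaceT => x /set_mem /AS; exact: cf.
- split.
  + by move=> x xab; have /dF [] := AS n x (subset_itv_oo_cc xab).
  + exact/cvg_at_right_filter/cF.
  + exact/cvg_at_left_filter/cF.
- move=> x xab; have /dF [_ <-] := AS n x (subset_itv_oo_cc xab).
  by rewrite derive1E.
Qed.

(** * Measurability of balls and volume of boxes *)

Lemma measurable_sqrt (R : realType) : measurable_fun setT (@Num.sqrt R).
Proof. by apply: continuous_measurable_fun; exact: sqrt_continuous. Qed.

Lemma measurable_sqnorm (R : realType) n : measurable_fun setT (@sqnorm R n).
Proof.
apply: measurable_sum => i.
by apply: (measurableT_comp (exprn_measurable 2)); exact: measurable_tnth.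
Qed.

Lemma measurable_eball (R : realType) n (u : Rn R n) r :
  measurable (eball u r).
Proof.
have -> : eball u r = setT `&`
    (fun v => Num.sqrt (sqnorm (taddv v (toppv u)))) @^-1` `]-oo, r].
  by rewrite setTI; apply/seteqP; split => v; rewrite /eball/= in_itv.
suff : measurable_fun setT (fun v => Num.sqrt (sqnorm (taddv v (toppv u)))).
  by move=> mf; apply: mf => //; exact: measurable_itv.
apply: (measurableT_comp (@measurable_sqrt R)).
apply: (measurableT_comp (@measurable_sqnorm R n)).
apply/measurable_fun_tnthP => i.
rewrite (_ : _ \o _ = fun v => tnth v i - tnth u i); last first.
  by apply/funext => v /=; rewrite !tnth_mktuple.
by apply: measurable_funB => //; exact: measurable_tnth.
Qed.

Lemma measurable_Bplus (R : realType) d r : measurable (@Bplus R d r).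
Proof.
apply: measurableI; last exact: measurable_halfspace.
have -> : [set x : Rd R d | Num.sqrt (sqnorm x.1 + x.2 ^+ 2) <= r] = setT `&`
    (fun x => Num.sqrt (sqnorm x.1 + x.2 ^+ 2)) @^-1` `]-oo, r].
  by rewrite setTI; apply/seteqP; split => v; rewrite /= in_itv.
suff : measurable_fun setT (fun x : Rd R d => Num.sqrt (sqnorm x.1 + x.2 ^+ 2)).
  by move=> mf; apply: mf => //; exact: measurable_itv.
apply: (measurableT_comp (@measurable_sqrt R)); apply: measurable_funD.
  by apply: (measurableT_comp (@measurable_sqnorm R d.-1)).
by apply: (measurableT_comp (exprn_measurable 2)).
Qed.

(** Closed balls for the sup norm: the iterated Lebesgue measure computes their
    volume directly, and they sandwich Euclidean balls. *)
Definition cube {R : realType} {n} (u : Rn R n) (r : R) : set (Rn R n) :=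
  [set v | forall i, `|tnth v i - tnth u i| <= r].

Lemma measurable_cube (R : realType) n (u : Rn R n) r : measurable (cube u r).
Proof.
have -> : cube u r = \bigcap_(i in [set: 'I_n])
    (setT `&` (fun v => tnth v i) @^-1` `[tnth u i - r, tnth u i + r]).
  apply/seteqP; split => v /= h i; last first.
    have [_] := h i I; by rewrite /= in_itv/= ler_distl.
  by move=> _; split => //=; rewrite in_itv/= -ler_distl.
apply: fin_bigcap_measurable => // i _.
by apply: (measurable_tnth i) => //; exact: measurable_itv.
Qed.

Lemma preimage_tcons_cube (R : realType) n (u : Rn R n.+1) r :
  @tcons R n @^-1` cube u r =
    cube [tuple of behead u] r `*` `[thead u - r, thead u + r]%classic.
Proof.
have tl i : tnth [tuple of behead u] i = tnth u (lift ord0 i).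
  by rewrite tnth_behead; congr tnth; apply/val_inj; rewrite /= inordK// ltnS.
apply/seteqP; split => -[v y] /=.
  move=> h; split => /=.
    by move=> i; have := h (lift ord0 i); rewrite tnthS tl.
  by have := h ord0; rewrite in_itv/= -ler_distl.
move=> [h1 h2] i; have [j ->|->] := unliftP ord0 i.
  by have := h1 j; rewrite tnthS -tl.
by move: h2; rewrite in_itv/= -ler_distl.
Qed.

Lemma lebesgue_centered_itv (R : realType) (a r : R) : 0 <= r ->
  lebesgue_measure `[a - r, a + r]%classic = (2 * r)%:E.
Proof.
move=> r0; rewrite lebesgue_measure_itv/= lte_fin.
case: ifPn => [_|]; first by rewrite -EFinB; congr _%:E; ring.
by rewrite -leNgt => h; congr _%:E; lra.
Qed.

Lemma lebesgue_cube (R : realType) n (u : Rn R n) r : 0 <= r ->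
  lebesgue_tuple n (cube u r) = ((2 * r) ^+ n)%:E.
Proof.
move=> r0; elim: n u => [|n ih] u.
  have -> : cube u r = setT by apply/seteqP; split => // v _ [].
  by rewrite /= diracT.
rewrite /= /pushforward preimage_tcons_cube product_measure1E; last 2 first.
- exact: measurable_cube.
- exact: measurable_itv.
by rewrite ih exprSr EFinM; congr (_ * _)%E; exact: lebesgue_centered_itv.
Qed.

(** * Comparison of the measures of the half-ball and of the cylinder *)

Lemma eball_sub_cube (R : realType) n (u : Rn R n) r : eball u r `<=` cube u r.
Proof.
move=> v; rewrite /eball /= => h i; apply: le_trans h.
rewrite -sqrtr_sqr ler_sqrt; last by apply: sumr_ge0 => j _; exact: sqr_ge0.
rewrite /sqnorm (bigD1 i)//= !tnth_mktuple lerDl.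
by apply: sumr_ge0 => j _; exact: sqr_ge0.
Qed.

(** With side r / d, the squared norm of a point of the box is at most
    d (r / d)^2 <= r^2; the last coordinate runs over [r / 2d, r / d],
    written as a centered interval, which keeps the box at height of order r. *)
Lemma cube_sub_Bplus (R : realType) d (r : R) : (0 < d)%N -> 0 < r ->
  cube (nseq_tuple d.-1 (0 : R) : Rn R d.-1) (r / d%:R) `*`
    `[3 / 4 * (r / d%:R) - 1 / 4 * (r / d%:R),
      3 / 4 * (r / d%:R) + 1 / 4 * (r / d%:R)]%classic `<=` Bplus d r.
Proof.
move=> d0 r0.
have dR : 1 <= d%:R :> R by rewrite ler1n.
have : 0 < r / d%:R by rewrite divr_gt0// ltr0n.
have : d%:R * (r / d%:R) ^+ 2 <= r ^+ 2.
  have -> : d%:R * (r / d%:R) ^+ 2 = r ^+ 2 / d%:R.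
    by field; rewrite pnatr_eq0 -lt0n.
  by rewrite ler_pdivrMr ?ltr0n// ler_peMr// sqr_ge0.
move: (r / d%:R) => k kr k0 [v y] /= [hv]; rewrite in_itv/= => /andP[y1 y2].
split => /=; last by rewrite /halfspace/=; lra.
rewrite -(ger0_norm (ltW r0)) -sqrtr_sqr ler_sqrt ?sqr_ge0//.
apply: le_trans kr.
rewrite -[in leRHS](prednK d0) -natr1 mulrDl mul1r lerD//; last first.
  by rewrite lerXn2r ?nnegrE//; lra.
apply: (@le_trans _ _ (\sum_(i < d.-1) k ^+ 2)); last first.
  by rewrite sumr_const card_ord mulr_natl.
apply: ler_sum => i _; have := hv i; rewrite tnth_nseq subr0 => h.
by rewrite -real_normK ?num_real// lerXn2r ?nnegrE ?normr_ge0// ltW.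
Qed.

Lemma lebesgue_box (R : realType) n (u : Rn R n) (t r h : R) :
  0 <= r -> 0 <= h ->
  (lebesgue_tuple n \x lebesgue_measure)%E
    (cube u r `*` `[t - h, t + h]%classic) = ((2 * r) ^+ n * (2 * h))%:E.
Proof.
move=> r0 h0; rewrite product_measure1E; last 2 first.
- exact: measurable_cube.
- exact: measurable_itv.
by rewrite lebesgue_cube// EFinM; congr (_ * _)%E; exact: lebesgue_centered_itv.
Qed.

(** The density of [nu] increases with the last coordinate, so on a box it lies
    between its values on the bottom and top faces. *)
Lemma nu_box_ge (R : realType) d (alpha : R) (u : Rn R d.-1) (t r h : R) :
  0 <= 2 * alpha + 1 -> 0 <= r -> 0 <= h -> h < t ->
  ((nu_density alpha (u, t - h) * ((2 * r) ^+ d.-1 * (2 * h)))%:E <=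
   nu d alpha (cube u r `*` `[(t - h)%R, (t + h)%R]%classic))%E.
Proof.
move=> a0 r0 h0 ht.
set A : set (Rd R d) := _ `*` _.
have mA : measurable A.
  by apply: measurableX; [exact: measurable_cube|exact: measurable_itv].
have AH : A `&` halfspace d = A.
  apply/setIidPl => -[v y] [_ /=].
  by rewrite in_itv/= /halfspace/= => /andP[+ _]; lra.
rewrite EFinM -(lebesgue_box _ _ u t)// -/A -integral_cst// /nu AH.
apply: ge0_le_integral => //.
- by move=> x _; rewrite lee_fin nu_density_ge0.
- by apply: measurable_funTS; apply/measurable_EFinP; exact: measurable_nu_density.
- move=> [v y] [_ /=]; rewrite in_itv/= => /andP[ty _].
  rewrite lee_fin /nu_density/=.
  rewrite ler_wpM2r ?invr_ge0 ?mulr_ge0 ?powR_ge0 ?Gamma_ge0//.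
  by rewrite ge0_ler_powR// nnegrE; lra.
Qed.

Lemma nu_box_le (R : realType) d (alpha : R) (u : Rn R d.-1) (t r h : R) :
  0 <= 2 * alpha + 1 -> 0 <= r -> 0 <= h ->
  (nu d alpha (cube u r `*` `[(t - h)%R, (t + h)%R]%classic) <=
  (nu_density alpha (u, (t + h)%R) * ((2 * r) ^+ d.-1 * (2 * h)))%:E)%E.
Proof.
move=> a0 r0 h0.
set A : set (Rd R d) := _ `*` _.
have mA : measurable A.
  by apply: measurableX; [exact: measurable_cube|exact: measurable_itv].
have mH := @measurable_halfspace R d.
rewrite EFinM -(lebesgue_box _ _ u t)// -/A.
apply: (@le_trans _ _
  (\int[(lebesgue_tuple d.-1 \x lebesgue_measure)%E]_(x in A `&` halfspace d)
     (cst (nu_density alpha (u, t + h))%:E x))%E).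
  apply: ge0_le_integral.
  - exact: measurableI.
  - by move=> x _; rewrite lee_fin nu_density_ge0.
  - apply: measurable_funTS; apply/measurable_EFinP.
    exact: measurable_nu_density.
  - exact: measurable_cst.
  - move=> [v y] [[_ /=]]; rewrite in_itv/= => /andP[_ yt].
    rewrite /halfspace/= => y0; rewrite lee_fin /nu_density/=.
    rewrite ler_wpM2r ?invr_ge0 ?mulr_ge0 ?powR_ge0 ?Gamma_ge0//.
    by rewrite ge0_ler_powR// nnegrE; lra.
rewrite integral_cst; last exact: measurableI.
rewrite lee_wpmul2l ?lee_fin ?nu_density_ge0// le_measure// ?inE//.
  exact: measurableI.
Qed.

Lemma le_nu (R : realType) d (alpha : R) (A B : set (Rd R d)) :
  measurable A -> measurable B -> A `<=` B ->
  (nu d alpha A <= nu d alpha B)%E.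
Proof. by move=> mA mB AB; apply: le_measure; rewrite ?inE. Qed.

(** Both measures are pinched between boxes; the normalizing constant of [nu]
    and the powers of [eps] cancel in the ratio. *)
Lemma nu_ratio_ge (R : realType) (d : nat) (alpha : R) :
  (0 < d)%N -> - (1 / 2) < alpha -> Gamma (alpha + 1) != 0 ->
  exists2 k : R, 0 < k & forall (x : Rd R d) (eps : R), 0 < x.2 -> 0 < eps ->
    ((k * (eps / (x.2 + eps)) `^ (2 * alpha + 1))%:E <=
     nu d alpha (Bplus d eps) / nu d alpha (Cplus x eps))%E.
Proof.
move=> d0 ha G0.
have g0 : 0 <= 2 * alpha + 1 by lra.
have dR : 0 < d%:R :> R by rewrite ltr0n.
exists ((2 * d%:R)^-1 `^ (2 * alpha + 1) * d%:R^-1 ^+ d.-1 * (4 * d%:R)^-1).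
  by rewrite !mulr_gt0 ?powR_gt0 ?exprn_gt0 ?invr_gt0 ?mulr_gt0.
move=> [u s] e /= s0 e0.
have [Z Z0 ZE] : exists2 Z : R, 0 < Z &
    forall (v : Rn R d.-1) (t : measurableTypeR R),
      nu_density alpha (v, t) = t `^ (2 * alpha + 1) / Z.
  exists ((2 * pi) `^ ((d%:R - 1) / 2) * 2 `^ alpha * Gamma (alpha + 1)) => //.
  apply: mulr_gt0; last by rewrite lt0r G0 Gamma_ge0.
  by apply: mulr_gt0; apply: powR_gt0 => //; apply: mulr_gt0 => //; exact: pi_gt0.
have k0 : 0 < e / d%:R by rewrite divr_gt0.
pose k := e / d%:R.
pose L := ((1 / 2) * k) `^ (2 * alpha + 1) / Z *
  ((2 * k) ^+ d.-1 * (2 * (1 / 4 * k))).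
pose U := (s + e) `^ (2 * alpha + 1) / Z * ((2 * e) ^+ d.-1 * (2 * e)).
have U0 : 0 < U.
  by rewrite /U !mulr_gt0 ?exprn_gt0 ?powR_gt0 ?invr_gt0 ?mulr_gt0 ?addr_gt0.
have hL : (L%:E <= nu d alpha (Bplus d e))%E.
  apply: le_trans (le_nu _ _ _ _ _ _ _ (cube_sub_Bplus _ _ _ d0 e0)); last 2 first.
  - apply: measurableX; [exact: measurable_cube|exact: measurable_itv].
  - exact: measurable_Bplus.
  apply: le_trans (nu_box_ge _ _ _ _ _ _ _ g0 _ _ _).
  + rewrite /L ZE (_ : _ - _ = 1 / 2 * k)//; rewrite /k.
    move: (e / d%:R) => ?; lra.
  + exact: ltW.
  + by rewrite mulr_ge0// ltW.
  + by rewrite ltr_pM2r//; lra.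
have hU : (nu d alpha (Cplus (u, s) e) <= U%:E)%E.
  rewrite /U -(ZE u (s + e)).
  apply: le_trans (nu_box_le _ _ _ u s e e g0 (ltW e0) (ltW e0)).
  apply: le_nu.
  - apply: measurableX; [exact: measurable_eball|exact: measurable_itv].
  - apply: measurableX; [exact: measurable_cube|exact: measurable_itv].
  - move=> [v y] [/= /eball_sub_cube hv]; rewrite !in_itv/= gt_max.
    move=> /andP[/andP[_ y1] y2].
    by split => //=; rewrite !ltW.
have S0 : 0 < (s + e) `^ (2 * alpha + 1) by rewrite powR_gt0// addr_gt0.
have qS : e `^ (2 * alpha + 1) =
    (e / (s + e)) `^ (2 * alpha + 1) * (s + e) `^ (2 * alpha + 1).
  by rewrite -powRM ?divr_ge0 ?ltW ?addr_gt0// divfK// gt_eqF// addr_gt0.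
have -> : (2 * d%:R)^-1 `^ (2 * alpha + 1) * d%:R^-1 ^+ d.-1 * (4 * d%:R)^-1
    * (e / (s + e)) `^ (2 * alpha + 1) = L / U.
  have kE : 1 / 2 * k = e * (2 * d%:R)^-1 by rewrite /k; field; rewrite gt_eqF.
  rewrite /L /U kE (@powRM _ e (2 * d%:R)^-1) ?invr_ge0 ?mulr_ge0 ?ltW// qS /k.
  have -> : (2 * (e / d%:R)) ^+ d.-1 = (2 * e) ^+ d.-1 * d%:R^-1 ^+ d.-1.
    by rewrite mulrA exprMn.
  have : 0 < (2 * e) ^+ d.-1 by rewrite exprn_gt0 ?mulr_gt0.
  move: ((2 * e) ^+ d.-1) (d%:R^-1 ^+ d.-1) => w z w0.
  by field; rewrite !gt_eqF.
have -> : (L / U)%:E = (L%:E * U%:E^-1)%E by rewrite inver gt_eqF.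
apply: lee_pmul => //.
- rewrite lee_fin /L /k.
  by rewrite !mulr_ge0 ?exprn_ge0 ?powR_ge0 ?invr_ge0 ?mulr_ge0 ?invr_ge0 ?ltW.
- by rewrite inve_ge0 lee_fin ltW.
- by rewrite lee_pV2// inE ?lee_fin ?(ltW U0)//; exact: measure_ge0.
Qed.

(** * Real powers near the endpoints *)

(** One constant serves both signs of [b]: the power is increasing or
    decreasing, and is compared with its value at [X] or at [X / 2]. *)
Lemma powR_le_half (R : realType) (b X M : R) : 0 < X -> X / 2 <= M <= X ->
  M `^ b <= (1 + 2 `^ (- b)) * X `^ b.
Proof.
move=> X0 /andP[XM MX]; have M0 : 0 < M by lra.
have [b0|b0] := leP 0 b.
  rewrite (@le_trans _ _ (X `^ b))//; first by rewrite ge0_ler_powR// nnegrE ltW.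
  by rewrite ler_peMl ?powR_ge0// lerDl powR_ge0.
rewrite (@le_trans _ _ (2 `^ (- b) * X `^ b))//; last first.
  by rewrite ler_wpM2r ?powR_ge0// lerDr.
have -> : 2 `^ (- b) * X `^ b = (X / 2) `^ b.
  rewrite powRM ?invr_ge0 ?(ltW X0)// mulrC.
  by rewrite -(powR_inv1 (ler0n R 2)) -powRrM mulN1r.
rewrite -[b]opprK !(powRN _ (- b)) lef_pV2 ?posrE ?powR_gt0 ?divr_gt0//.
by rewrite ge0_ler_powR// ?nnegrE; lra.
Qed.

(** The larger of [u] and [v] lies between [(u + v) / 2] and [u + v]. *)
Lemma powRM_le_sum (R : realType) (b u v : R) : 0 < u -> 0 < v ->
  u `^ b * v `^ b <= (1 + 2 `^ (- b)) * (u + v) `^ b * (u `^ b + v `^ b).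
Proof.
wlog uv : u v / u <= v.
  move=> H u0 v0; have [uv|vu] := leP u v; first exact: H.
  by rewrite mulrC (addrC u) (addrC (u `^ b)) H// ltW.
move=> u0 v0; rewrite mulrC ler_pM ?powR_ge0//; last by rewrite lerDl powR_ge0.
by apply: powR_le_half; rewrite ?addr_gt0//; apply/andP; split; lra.
Qed.

Lemma powR_continuous (R : realType) (b x : R) : 0 < x ->
  {for x, continuous (fun y => y `^ b)}.
Proof.
move=> x0; have [d _] := is_derive1_powR b x0.
exact/differentiable_continuous/derivable1_diffP.
Qed.

(** The power [b] may be negative: the integrand then blows up at [p], and
    [0 < b + 1] makes its primitive bounded. *)
Lemma integral_lower_endpoint (R : realType) (b p q : R) :
  0 < b + 1 -> 0 <= p -> p <= q ->
  (\int[lebesgue_measure]_(r in `]p, q[) ((r ^+ 2 - p ^+ 2) `^ b * r)%:E <=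
   ((q ^+ 2 - p ^+ 2) `^ (b + 1) / (2 * (b + 1)))%:E)%E.
Proof.
move=> b0 p0 pq.
pose F (r : R) := (r ^+ 2 - p ^+ 2) `^ (b + 1) / (2 * (b + 1)).
have sq r : p < r -> 0 < r ^+ 2 - p ^+ 2.
  by move=> pr; rewrite subr_sqr mulr_gt0; lra.
have -> : (q ^+ 2 - p ^+ 2) `^ (b + 1) / (2 * (b + 1)) = F q - F p.
  by rewrite /F subrr powR0 ?mul0r ?subr0// gt_eqF.
have c0 : b + 1 != 0 by rewrite gt_eqF.
have dq r : is_derive r (1 : R) (fun r : R => r ^+ 2 - p ^+ 2) (2 * r).
  by apply: is_derive_eq; rewrite /GRing.scale/=; ring.
apply: le_integral_antideriv => //.
- move=> r; rewrite in_itv/= => /andP[pr rq].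
  have d1 := is_derive1_powR (b + 1) (sq r pr).
  have -> : F = (2 * (b + 1))^-1 \*:
      ((fun y => y `^ (b + 1)) \o (fun r : R => r ^+ 2 - p ^+ 2)).
    by apply/funext => y; rewrite /F/= mulrC.
  have d2 := is_derive1_comp (f := fun y => y `^ (b + 1))
    (g := fun r : R => r ^+ 2 - p ^+ 2) d1 (dq r).
  have d3 := is_deriveZ (2 * (b + 1))^-1 d2.
  apply: is_derive_eq d3 _.
  rewrite addrK /GRing.scale/=; field; exact: c0.
- move=> r; rewrite in_itv/= => /andP[pr rq].
  apply: cvgM; last exact: cvg_id.
  have [dr _] := dq r.
  have cr : {for r, continuous (fun r : R => r ^+ 2 - p ^+ 2)}.
    exact/differentiable_continuous/derivable1_diffP.
  apply: (cvg_comp (fun r => r ^+ 2 - p ^+ 2) (fun y => y `^ b) cr).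
  exact/powR_continuous/sq.
- move=> r; rewrite in_itv/= => /andP[pr rq].
  by rewrite mulr_ge0 ?powR_ge0//; lra.
- move=> r r'; rewrite !in_itv/= => /andP[pr _] /andP[pr' _] rr'.
  rewrite /F ler_wpM2r ?invr_ge0 ?mulr_ge0 ?(ltW b0)//.
  have h : p ^+ 2 <= r ^+ 2 <= r' ^+ 2.
    by rewrite !lerXn2r ?nnegrE//; lra.
  by rewrite ge0_ler_powR// ?nnegrE; lra.
Qed.

Lemma integral_upper_endpoint (R : realType) (b p q : R) :
  0 < b + 1 -> 0 <= p -> p <= q ->
  (\int[lebesgue_measure]_(r in `]p, q[) ((q ^+ 2 - r ^+ 2) `^ b * r)%:E <=
   ((q ^+ 2 - p ^+ 2) `^ (b + 1) / (2 * (b + 1)))%:E)%E.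
Proof.
move=> b0 p0 pq.
pose F (r : R) := - (q ^+ 2 - r ^+ 2) `^ (b + 1) / (2 * (b + 1)).
have sq r : 0 <= r -> r < q -> 0 < q ^+ 2 - r ^+ 2.
  by move=> r0 rq; rewrite subr_sqr mulr_gt0; lra.
have -> : (q ^+ 2 - p ^+ 2) `^ (b + 1) / (2 * (b + 1)) = F q - F p.
  by rewrite /F subrr powR0 ?oppr0 ?mul0r ?sub0r ?mulNr ?opprK// gt_eqF.
have c0 : b + 1 != 0 by rewrite gt_eqF.
have dq r : is_derive r (1 : R) (fun r : R => q ^+ 2 - r ^+ 2) (- (2 * r)).
  by apply: is_derive_eq; rewrite /GRing.scale/=; ring.
apply: le_integral_antideriv => //.
- move=> r; rewrite in_itv/= => /andP[pr rq].
  have d1 := is_derive1_powR (b + 1) (sq r (ltW (le_lt_trans p0 pr)) rq).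
  have -> : F = (- (2 * (b + 1))^-1) \*:
      ((fun y => y `^ (b + 1)) \o (fun r : R => q ^+ 2 - r ^+ 2)).
    by apply/funext => y; rewrite /F/= mulNr mulrC -mulNr.
  have d2 := is_derive1_comp (f := fun y => y `^ (b + 1))
    (g := fun r : R => q ^+ 2 - r ^+ 2) d1 (dq r).
  have d3 := is_deriveZ (- (2 * (b + 1))^-1) d2.
  apply: is_derive_eq d3 _.
  rewrite addrK /GRing.scale/=; field; exact: c0.
- move=> r; rewrite in_itv/= => /andP[pr rq].
  apply: cvgM; last exact: cvg_id.
  have [dr _] := dq r.
  have cr : {for r, continuous (fun r : R => q ^+ 2 - r ^+ 2)}.
    exact/differentiable_continuous/derivable1_diffP.
  apply: (cvg_comp (fun r => q ^+ 2 - r ^+ 2) (fun y => y `^ b) cr).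
  exact/powR_continuous/sq/rq/ltW/(le_lt_trans p0).
- move=> r; rewrite in_itv/= => /andP[pr rq].
  by rewrite mulr_ge0 ?powR_ge0//; lra.
- move=> r r'; rewrite !in_itv/= => /andP[pr rq] /andP[pr' rq'] rr'.
  rewrite /F ler_wpM2r ?invr_ge0 ?mulr_ge0 ?(ltW b0)//.
  have h : r ^+ 2 <= r' ^+ 2 <= q ^+ 2.
    by rewrite !lerXn2r ?nnegrE//; lra.
  by rewrite lerN2 ge0_ler_powR// ?nnegrE; lra.
Qed.

(** * The kernel of the translation *)

Definition Wconst {R : realType} (alpha : R) : R :=
  Gamma (alpha + 1) /
  (2 `^ (2 * alpha - 1) * Num.sqrt pi * Gamma (alpha + 1 / 2)).

Lemma Wconst_ge0 (R : realType) (alpha : R) : 0 <= Wconst alpha.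
Proof. by rewrite divr_ge0 ?mulr_ge0 ?Gamma_ge0 ?powR_ge0 ?sqrtr_ge0. Qed.

Lemma W_ge0 (R : realType) (alpha s t r : R) : 0 <= W alpha s t r.
Proof.
rewrite /W; case: ifP => // _.
by rewrite divr_ge0 ?mulr_ge0 ?Gamma_ge0 ?powR_ge0 ?sqrtr_ge0.
Qed.

Lemma W_supp (R : realType) (alpha s t r : R) :
  ~~ (`|s - t| < r < s + t) -> W alpha s t r = 0.
Proof. by rewrite /W => /negbTE ->. Qed.

Lemma measurable_W (R : realType) (alpha s t : R) :
  measurable_fun setT (W alpha s t).
Proof.
have msq : measurable_fun setT (fun r : R => r ^+ 2) := exprn_measurable 2.
apply: measurable_fun_ifT => //.
  by apply: measurable_and; apply: measurable_fun_ltr.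
under eq_fun do rewrite invfM -powRN.
apply: measurable_funM.
  apply: measurable_funM; first apply: measurable_funM => //.
    by apply: (measurableT_comp (measurable_powR _)); apply: measurable_funB.
  by apply: (measurableT_comp (measurable_powR _)); apply: measurable_funB.
apply: measurable_funM => //.
by apply: (measurableT_comp (measurable_powR _)); apply: measurable_funM.
Qed.

(** The factor [r ^ (2 alpha)] of the weight cancels the one in the denominator
    of the kernel, leaving the single factor [r] that makes [r^2] the natural
    variable.  Writing [`|s - t| ^+ 2] exposes the lower endpoint. *)
Lemma W_weighted (R : realType) (alpha s t r : R) :
  0 < s -> 0 < t -> `|s - t| < r < s + t ->
  W alpha s t r * r `^ (2 * alpha + 1) =
  Wconst alpha * (s * t) `^ (- (2 * alpha)) *
    (((s + t) ^+ 2 - r ^+ 2) `^ (alpha - 1 / 2) *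
     (r ^+ 2 - `|s - t| ^+ 2) `^ (alpha - 1 / 2)) * r.
Proof.
move=> s0 t0 h; rewrite /W h.
have r0 : 0 < r by case/andP: h => h _; apply: le_lt_trans h.
rewrite powRM ?mulr_ge0 ?ltW// powRN (@powRD _ r) ?(gt_eqF r0) ?implybT//.
rewrite powRr1 ?ltW// real_normK ?num_real// /Wconst !invfM.
have /divff : r `^ (2 * alpha) != 0 by rewrite gt_eqF ?powR_gt0.
move: (r `^ (2 * alpha)) => z zz.
by rewrite -[RHS]mulr1 -zz; ring.
Qed.

Lemma integral_le_itv (R : realType) (f g : R -> R) (p q c M : R) :
  0 <= p -> 0 <= c ->
  measurable_fun setT f -> measurable_fun setT g ->
  (forall r, 0 <= f r) -> (forall r, ~~ (p < r < q) -> f r = 0) ->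
  (forall r, p < r < q -> 0 <= g r /\ f r <= c * g r) ->
  (\int[lebesgue_measure]_(r in `]p, q[) (g r)%:E <= M%:E)%E ->
  (\int[lebesgue_measure]_(r in `]0%R, +oo[) (f r)%:E <= (c * M)%:E)%E.
Proof.
move=> p0 c0 mf mg f0 fz fg gM.
rewrite integral_mkcond.
rewrite (_ : _ \_ _ = (fun r => (f r)%:E) \_ `]p, q[); last first.
  apply/funext => r; rewrite !patchE.
  case: ifPn; case: ifPn => //; rewrite !mem_setE !in_itv/= ?andbT => h1 h2.
  - by rewrite (fz _ h1).
  - by case/andP: h1 h2 => pr _; rewrite (le_lt_trans p0 pr).
rewrite -integral_mkcond.
apply: (@le_trans _ _ (\int[lebesgue_measure]_(r in `]p, q[) (c%:E * (g r)%:E))%E).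
  apply: ge0_le_integral => //.
  - by move=> r _; rewrite lee_fin.
  - by apply: measurable_funTS; apply/measurable_EFinP.
  - apply: measurable_funTS; apply: emeasurable_funM => //; exact/measurable_EFinP.
  - move=> r /=; rewrite in_itv/= => /fg[_ h]; by rewrite -EFinM lee_fin.
rewrite ge0_integralZl//.
- by rewrite EFinM lee_wpmul2l// lee_fin.
- by apply: measurable_funTS; apply/measurable_EFinP.
- by move=> r /=; rewrite in_itv/= => /fg[h _]; rewrite lee_fin.
Qed.

Lemma measurable_lower_edge (R : realType) (b a : R) :
  measurable_fun setT (fun r : R => (r ^+ 2 - a) `^ b * r).
Proof.
apply: measurable_funM => //.
by apply: (measurableT_comp (measurable_powR _)); apply: measurable_funB.
Qed.

Lemma measurable_upper_edge (R : realType) (b a : R) :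
  measurable_fun setT (fun r : R => (a - r ^+ 2) `^ b * r).
Proof.
apply: measurable_funM => //.
by apply: (measurableT_comp (measurable_powR _)); apply: measurable_funB.
Qed.

Lemma endpoint_gap (R : realType) (s t : R) :
  (s + t) ^+ 2 - `|s - t| ^+ 2 = 4 * (s * t).
Proof. by rewrite real_normK ?num_real//; ring. Qed.

(** The two brackets of the kernel add up to [4 s t], so their product splits
    into two one-sided singularities, each integrable over the whole
    support; all powers of [s t] cancel. *)
Lemma integral_W_le_const (R : realType) (alpha b s t : R) (f : R -> R) :
  b = alpha - 1 / 2 -> 0 < b + 1 -> 0 < s -> 0 < t ->
  measurable_fun setT f -> (forall r, 0 <= f r) ->
  (forall r, f r <= W alpha s t r * r `^ (2 * alpha + 1)) ->
  (\int[lebesgue_measure]_(r in `]0%R, +oo[) (f r)%:E <=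
   (Wconst alpha * (1 + 2 `^ (- b)) * 4 `^ (2 * alpha) / (b + 1))%:E)%E.
Proof.
move=> bE b0 s0 t0 mf f0 fW; set C := 1 + _.
have [k k0 kE] : exists2 k : R, 0 <= k & Wconst alpha = k.
  by exists (Wconst alpha); first exact: Wconst_ge0.
rewrite kE; have C0 : 0 <= C by rewrite /C addr_ge0// powR_ge0.
have st0 : 0 < s * t by rewrite mulr_gt0.
have pQ : `|s - t| <= s + t by rewrite ler_norml; apply/andP; split; lra.
have -> : k * C * 4 `^ (2 * alpha) / (b + 1) =
    k * (s * t) `^ (- (2 * alpha)) * (C * (4 * (s * t)) `^ b) *
    ((4 * (s * t)) `^ (b + 1) / (2 * (b + 1)) +
     (4 * (s * t)) `^ (b + 1) / (2 * (b + 1))).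
  have h : (4 * (s * t)) `^ b * (4 * (s * t)) `^ (b + 1) *
      (s * t) `^ (- (2 * alpha)) = 4 `^ (2 * alpha).
    have z0 : 4 * (s * t) != 0 by rewrite gt_eqF ?mulr_gt0.
    rewrite -powRD ?z0 ?implybT//.
    have -> : b + (b + 1) = 2 * alpha by rewrite bE; field.
    by rewrite powRM ?ltW// powRN mulfK// gt_eqF ?powR_gt0.
  by rewrite -h; field; rewrite gt_eqF.
apply: (@integral_le_itv _ _ (fun r => (r ^+ 2 - `|s - t| ^+ 2) `^ b * r +
    ((s + t) ^+ 2 - r ^+ 2) `^ b * r) `|s - t| (s + t)) => //.
- by rewrite mulr_ge0 ?[0 <= k * _]mulr_ge0 ?[0 <= C * _]mulr_ge0 ?powR_ge0.
- apply: measurable_funD; first exact: measurable_lower_edge.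
  exact: measurable_upper_edge.
- move=> r h; apply/le_anti; rewrite f0 andbT (le_trans (fW r))//.
  by rewrite W_supp// mul0r.
- move=> r h; have /andP[pr rQ] := h.
  have r0 : 0 < r by rewrite (le_lt_trans _ pr).
  split; first by rewrite addr_ge0// mulr_ge0 ?powR_ge0// ltW.
  apply: le_trans (fW _) _; rewrite W_weighted// -bE kE -mulrDl !(mulrA _ _ r).
  rewrite ler_wpM2r ?(ltW r0)// -[leRHS]mulrA ler_wpM2l ?mulr_ge0 ?powR_ge0//.
  have -> : 4 * (s * t) = ((s + t) ^+ 2 - r ^+ 2) + (r ^+ 2 - `|s - t| ^+ 2).
    by rewrite -endpoint_gap; ring.
  rewrite [X in _ <= _ * X]addrC powRM_le_sum//.
    by rewrite subr_sqr mulr_gt0; lra.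
  by rewrite subr_sqr mulr_gt0 ?subr_gt0// ltr_wpDr.
- under eq_integral do rewrite EFinD.
  rewrite ge0_integralD//.
  + rewrite EFinD leeD// -endpoint_gap.
      exact: integral_lower_endpoint.
    exact: integral_upper_endpoint.
  + move=> r /=; rewrite in_itv/= => /andP[pr _].
    by rewrite lee_fin mulr_ge0 ?powR_ge0// (le_trans _ (ltW pr)).
  + apply: measurable_funTS; apply/measurable_EFinP; exact: measurable_lower_edge.
  + move=> r /=; rewrite in_itv/= => /andP[pr _].
    by rewrite lee_fin mulr_ge0 ?powR_ge0// (le_trans _ (ltW pr)).
  + apply: measurable_funTS; apply/measurable_EFinP; exact: measurable_upper_edge.
Qed.

(** Since [r < s], the bracket at the upper endpoint stays comparable to
    [4 s t] and only the singularity at [`|s - t|] remains.  The integral is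
    taken up to [2 e] rather than [e], so that the point [r = e], where [f] may
    be nonzero, is interior. *)
Lemma integral_W_le_small_radius (R : realType) (alpha b s t e : R) (f : R -> R) :
  b = alpha - 1 / 2 -> 0 < b + 1 -> 0 < s -> 0 < t -> 0 < e -> 4 * e < s ->
  measurable_fun setT f -> (forall r, 0 <= f r) ->
  (forall r, f r <= W alpha s t r * r `^ (2 * alpha + 1)) ->
  (forall r, e < r -> f r = 0) ->
  (\int[lebesgue_measure]_(r in `]0%R, +oo[) (f r)%:E <=
   (Wconst alpha * (1 + 2 `^ (- b)) * 4 `^ b * 32 `^ (b + 1) / (2 * (b + 1)) *
      (e / (s + e)) `^ (2 * alpha + 1))%:E)%E.
Proof.
move=> bE b0 s0 t0 e0 es mf f0 fW fe; set C := 1 + _.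
have [k k0 kE] : exists2 k : R, 0 <= k & Wconst alpha = k.
  by exists (Wconst alpha); first exact: Wconst_ge0.
rewrite kE; have C0 : 0 <= C by rewrite /C addr_ge0// powR_ge0.
have st0 : 0 < s * t by rewrite mulr_gt0.
have fz r : ~~ (`|s - t| < r < s + t) -> f r = 0.
  move=> h; apply/le_anti; rewrite f0 andbT (le_trans (fW r))//.
  by rewrite W_supp// mul0r.
(* If the support of the kernel starts beyond the radius, f vanishes. *)
have [ep|pe] := leP (2 * e) `|s - t|.
  have fz0 r : f r = 0.
    have [/fe//|re] := ltP e r.
    by apply: fz; rewrite negb_and -leNgt (le_trans re)// (le_trans _ ep)//; lra.
  rewrite integral0_eq => [|r _]; last by rewrite fz0.
  rewrite lee_fin.
  do 2!(apply: mulr_ge0;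
    last by rewrite ?powR_ge0 ?invr_ge0 ?mulr_ge0// ltW).
  by rewrite mulr_ge0 ?[0 <= k * _ * _]mulr_ge0 ?[0 <= k * _]mulr_ge0 ?powR_ge0.
have p0 : 0 <= `|s - t| := normr_ge0 _.
have ts : s / 2 < t by move: pe; rewrite ltr_norml => /andP[]; lra.
apply: (@le_trans _ _ (k * (s * t) `^ (- (2 * alpha)) *
    (C * (4 * (s * t)) `^ b) *
    (((2 * e) ^+ 2 - `|s - t| ^+ 2) `^ (b + 1) / (2 * (b + 1))))%:E).
  apply: (@integral_le_itv _ _ (fun r => (r ^+ 2 - `|s - t| ^+ 2) `^ b * r)
      `|s - t| (2 * e)) => //.
  - by rewrite mulr_ge0 ?[0 <= k * _]mulr_ge0 ?[0 <= C * _]mulr_ge0 ?powR_ge0.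
  - exact: measurable_lower_edge.
  - move=> r; rewrite negb_and -!leNgt => /orP[rp|er].
      by apply: fz; rewrite negb_and -leNgt rp.
    by apply: fe; lra.
  - move=> r /andP[pr re].
    have r0 : 0 < r by rewrite (le_lt_trans _ pr).
    split; first by rewrite mulr_ge0 ?powR_ge0// ltW.
    apply: le_trans (fW _) _; rewrite W_weighted// -?bE ?kE; last first.
      by rewrite pr/=; lra.
    rewrite !(mulrA _ _ r) ler_wpM2r ?(ltW r0)// -(mulrA _ (C * _)).
    rewrite ler_wpM2l ?mulr_ge0 ?powR_ge0// ler_wpM2r ?powR_ge0//.
    apply: powR_le_half; first by rewrite mulr_gt0.
    have h1 : `|s - t| ^+ 2 <= r ^+ 2 by rewrite lerXn2r ?nnegrE// ltW.
    have h2 : r ^+ 2 <= s ^+ 2 by rewrite lerXn2r ?nnegrE//; lra.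
    have := endpoint_gap _ s t; rewrite sqrrD.
    have := sqr_ge0 t.
    rewrite mulr2n => ? ?; apply/andP; split; lra.
  - apply: integral_lower_endpoint => //; exact: ltW.
set q := e / (s + e).
have q0 : 0 < q by rewrite divr_gt0// addr_gt0.
have qe : e = q * (s + e) by rewrite /q divfK// gt_eqF// addr_gt0.
clearbody q.
(* From s + e <= 2 s and s < 2 t: (2 e)^2 = 4 q^2 (s + e)^2 <= 32 q^2 s t. *)
have key : ((2 * e) ^+ 2 - `|s - t| ^+ 2) `^ (b + 1) <=
    32 `^ (b + 1) * q `^ (2 * alpha + 1) * (s * t) `^ (b + 1).
  have -> : 2 * alpha + 1 = 2%:R * (b + 1) by rewrite bE; field.
  rewrite powRrM powR_mulrn ?(ltW q0)//.
  rewrite -!powRM ?mulr_ge0 ?sqr_ge0 ?(ltW q0) ?(ltW s0) ?(ltW t0)//.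
  have h1 : `|s - t| ^+ 2 <= (2 * e) ^+ 2.
    by rewrite lerXn2r ?nnegrE ?normr_ge0// ltW// mulr_gt0.
  have h2 : (2 * e) ^+ 2 <= 32 * q ^+ 2 * (s * t).
    have -> : (2 * e) ^+ 2 = q ^+ 2 * (4 * (s + e) ^+ 2) by rewrite {1}qe; ring.
    have -> : 32 * q ^+ 2 * (s * t) = q ^+ 2 * (32 * (s * t)) by ring.
    rewrite ler_wpM2l ?sqr_ge0//; nra.
  have h3 := sqr_ge0 `|s - t|.
  rewrite ge0_ler_powR// ?nnegrE ?(ltW b0) ?subr_ge0// ?(le_trans (sqr_ge0 _) h2)//.
  by apply: le_trans h2; rewrite gerBl.
rewrite lee_fin.
have z0 : 0 < (s * t) `^ (b + 1) by rewrite powR_gt0.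
have hst : (s * t) `^ (- (2 * alpha)) * (4 * (s * t)) `^ b =
    4 `^ b / (s * t) `^ (b + 1).
  have st1 : s * t != 0 by rewrite gt_eqF.
  rewrite (@powRM _ 4 (s * t)) ?(ltW st0)// mulrCA -powRD ?st1 ?implybT//.
  by rewrite -powRN; congr (_ * _ `^ _); rewrite bE; field.
set D := ((2 * e) ^+ 2 - `|s - t| ^+ 2) `^ (b + 1) in key *.
have -> : k * (s * t) `^ (- (2 * alpha)) * (C * (4 * (s * t)) `^ b) *
    (D / (2 * (b + 1))) =
    k * C * 4 `^ b / (2 * (b + 1)) * (D / (s * t) `^ (b + 1)).
  rewrite mulrA (_ : k * _ * _ = k * C *
    ((s * t) `^ (- (2 * alpha)) * (4 * (s * t)) `^ b)); last by ring.
  by rewrite hst; field; rewrite !gt_eqF.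
have -> : k * C * 4 `^ b * 32 `^ (b + 1) / (2 * (b + 1)) *
    q `^ (2 * alpha + 1) = k * C * 4 `^ b / (2 * (b + 1)) *
    (32 `^ (b + 1) * q `^ (2 * alpha + 1)) by field; rewrite gt_eqF.
rewrite ler_wpM2l ?ler_pdivrMr//.
by rewrite divr_ge0 ?mulr_ge0 ?powR_ge0// ltW.
Qed.

(** The threshold is [4 e = s]; beyond it [e / (s + e) >= 1 / 5], which absorbs
    the constant bound.  The function [f] stands for the kernel cut off by a
    section of the half-ball. *)
Lemma integral_W_le (R : realType) (alpha : R) : - (1 / 2) < alpha ->
  exists2 K : R, 0 <= K & forall (s t e : R) (f : R -> R),
  0 < s -> 0 < t -> 0 < e ->
  measurable_fun setT f -> (forall r, 0 <= f r) ->
  (forall r, f r <= W alpha s t r * r `^ (2 * alpha + 1)) ->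
  (forall r, e < r -> f r = 0) ->
  (\int[lebesgue_measure]_(r in `]0%R, +oo[) (f r)%:E <=
   (K * (e / (s + e)) `^ (2 * alpha + 1))%:E)%E.
Proof.
move=> ha; have [b bE] : exists b, b = alpha - 1 / 2 by exists (alpha - 1 / 2).
have b0 : 0 < b + 1 by rewrite bE; lra.
set Kf := Wconst alpha * (1 + 2 `^ (- b)) * 4 `^ (2 * alpha) / (b + 1).
set Kn := Wconst alpha * (1 + 2 `^ (- b)) * 4 `^ b * 32 `^ (b + 1) / (2 * (b + 1)).
have k0 := Wconst_ge0 _ alpha.
have C0 : 0 <= 1 + 2 `^ (- b) by rewrite addr_ge0// powR_ge0.
have Kf0 : 0 <= Kf.
  by rewrite divr_ge0 ?(ltW b0)// mulr_ge0 ?powR_ge0// mulr_ge0.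
have Kn0 : 0 <= Kn.
  rewrite divr_ge0 ?[0 <= 2 * _]mulr_ge0 ?(ltW b0)//.
  by rewrite mulr_ge0 ?powR_ge0// mulr_ge0 ?powR_ge0// mulr_ge0.
exists (Kf * 5 `^ (2 * alpha + 1) + Kn).
  by rewrite addr_ge0// mulr_ge0// powR_ge0.
move=> s t e f s0 t0 e0 mf f0 fW fe.
have q0 : 0 <= (e / (s + e)) `^ (2 * alpha + 1) by exact: powR_ge0.
have [es|se] := ltP (4 * e) s.
  apply: le_trans
    (integral_W_le_small_radius _ _ _ _ _ _ _ bE b0 s0 t0 e0 es mf f0 fW fe) _.
  by rewrite lee_fin ler_wpM2r// lerDr mulr_ge0// powR_ge0.
apply: le_trans (integral_W_le_const _ _ _ _ _ _ bE b0 s0 t0 mf f0 fW) _.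
rewrite lee_fin -/Kf mulrDl -mulrA (@le_trans _ _ (Kf * 1))//.
  by rewrite mulr1.
rewrite (@le_trans _ _ (Kf * (5 `^ (2 * alpha + 1) *
    (e / (s + e)) `^ (2 * alpha + 1))))//; last first.
  by rewrite lerDl mulr_ge0.
rewrite ler_wpM2l// -powRM ?divr_ge0 ?addr_ge0 ?(ltW s0) ?(ltW e0)//.
apply: (@le_trans _ _ (1 `^ (2 * alpha + 1))); first by rewrite powR1.
have q1 : 1 <= 5 * (e / (s + e)).
  by rewrite mulrA ler_pdivlMr ?addr_gt0//; lra.
by rewrite ge0_ler_powR ?nnegrE// ?(le_trans _ q1)//; lra.
Qed.

(** * The translation of the half-ball *)

Theorem lemma3p3 (R : realType) (d : nat) (alpha : R) (hd : (2 <= d)%N)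
    (halpha : - (1 / 2) < alpha) (halphad : d%:R / 2 - 1 < alpha) :
  exists c : R, 0 < c /\
    forall x : Rd R d, halfspace d x ->
    forall eps : R, 0 < eps ->
    {ae nu d alpha, forall y : Rd R d, halfspace d y ->
      (0 <= weinstein_translation alpha x \1_(Bplus d eps) (toppv y.1, y.2)
         <= c%:E * (nu d alpha (Bplus d eps) / nu d alpha (Cplus x eps)))%E}.
Proof.
have d0 : (0 < d)%N by apply: ltn_trans hd.
have tge0 x e y : (0 <=
    weinstein_translation alpha x \1_(Bplus d e) (toppv y.1, y.2))%E.
  apply: integral_ge0 => r _; rewrite lee_fin.
  by rewrite !mulr_ge0 ?W_ge0 ?powR_ge0.
(* If Gamma (alpha + 1) is 0 the kernel vanishes identically; otherwise it is
   positive, and so is the normalizing constant of nu. *)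
have [G0|G0] := eqVneq (Gamma (alpha + 1)) 0.
  exists 1; split => // x _ e _; apply: aeW => y _; rewrite tge0/=.
  rewrite /weinstein_translation integral0_eq => [|r _].
    by rewrite mule_ge0// mule_ge0 ?inve_ge0 ?measure_ge0.
  by rewrite /W G0; case: ifP => _; rewrite ?mul0r ?mulr0 ?mul0r.
have [K K0 hK] := integral_W_le _ _ halpha.
have [k k0 hk] := nu_ratio_ge _ _ _ d0 halpha G0.
exists ((K + 1) / k); split; first by rewrite divr_gt0// ltr_wpDl.
move=> x xH e e0; apply: aeW => y yH; rewrite tge0/=.
apply: (@le_trans _ _ (((K + 1) / k)%:E *
    (k * (e / (x.2 + e)) `^ (2 * alpha + 1))%:E)%E); last first.
  by rewrite lee_wpmul2l ?lee_fin ?divr_ge0 ?addr_ge0 ?(ltW k0)//; exact: hk.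
rewrite -EFinM mulrA divfK ?gt_eqF//.
apply: (@le_trans _ _ (K * (e / (x.2 + e)) `^ (2 * alpha + 1))%:E); last first.
  by rewrite lee_fin ler_wpM2r ?powR_ge0// lerDl.
apply: (hK _ y.2) => //.
- apply: measurable_funM; last exact: measurable_powR.
  apply: measurable_funM; last exact: measurable_W.
  have mB : measurable_fun setT (\1_(Bplus d e) : Rd R d -> R).
    by apply: measurable_indic; exact: measurable_Bplus.
  have mp := @pair1_measurable _ _ (Rn R d.-1) (measurableTypeR R)
    (taddv x.1 (toppv y.1)).
  exact: measurableT_comp mB mp.
- by move=> r; rewrite !mulr_ge0 ?W_ge0 ?powR_ge0.
- by move=> r; rewrite ler_wpM2r ?powR_ge0// ler_piMl ?W_ge0.
- move=> r er; rewrite indicE memNset ?mul0r// => -[/= h _].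
  have : r <= e.
    have r0 : 0 <= r by rewrite (le_trans (ltW e0))// ltW.
    have n0 : 0 <= sqnorm (taddv x.1 (toppv y.1)).
      by apply: sumr_ge0 => i _; exact: sqr_ge0.
    apply: le_trans h; rewrite -[leLHS](ger0_norm r0) -sqrtr_sqr.
    by rewrite ler_sqrt ?addr_ge0 ?sqr_ge0 ?lerDr.
  by rewrite leNgt er.
Qed.
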